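(* Let $\Lambda=\mathbb{Z}[t^{\pm1},s^{\pm1}]$, let $M$ be a $\Lambda$-module regarded as an Alexander biquandle, with corresponding Alexander quandle $\mathcal{Q}(M)$. Then $$Aut(M)\cong C_{Aut(\mathcal{Q}(M))}(s),$$ the centralizer in $Aut(\mathcal{Q}(M))$ of the automorphism $x\mapsto sx$, where $Aut(M)$ is the biquandle automorphism group.
   Context: The Alexander biquandle on a $\Lambda$-module $M$, where $\Lambda=\mathbb{Z}[t^{\pm1},s^{\pm1}]$, is the set $M$ with the two binary operations $x\,\underline{\ast}\,y=tx+(s-t)y$ and $x\,\overline{\ast}\,y=sx$. $Aut(M)$ denotes the group of bijections $M\to M$ preserving both operations (not the group of module automorphisms). The corresponding Alexander quandle $\mathcal{Q}(M)$ is the set $M$ with the operation $x*y=(s^{-1}t)x+(1-s^{-1}t)y$; $Aut(\mathcal{Q}(M))$ is the group of bijections of $M$ preserving $*$. The symbol $s$ in the centralizer denotes the map $M\to M$, $x\mapsto sx$, which is an element of $Aut(\mathcal{Q}(M))$. *)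

(* Defs.v *)
From HB Require Import structures.
From mathcomp Require Import all_boot all_order all_algebra.
From mathcomp Require Import boolp.

Set Implicit Arguments.
Unset Strict Implicit.
Unset Printing Implicit Defensive.

Import GRing.Theory.
Local Open Scope ring_scope.

Section Symmetric.
Variable T : choiceType.

Record sym := Sym { sym_fun :> T -> T; sym_bij : `[< bijective sym_fun >] }.

HB.instance Definition _ := [isSub for sym_fun].
HB.instance Definition _ := [Choice of sym by <:].

Lemma symP (f g : sym) : (forall x, f x = g x) -> f = g.
Proof. by move=> fg; apply/val_inj/funext. Qed.

Lemma sym_cancel (f : sym) : exists g : T -> T, cancel f g /\ cancel g f.
Proof. by have /asboolP[g fK gK] := sym_bij f; exists g. Qed.

Definition sym_inv_fun (f : sym) : T -> T := sval (cid (sym_cancel f)).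

Lemma sym_funK f : cancel (sym_fun f) (sym_inv_fun f).
Proof. by rewrite /sym_inv_fun; case: cid => g []. Qed.

Lemma sym_funVK f : cancel (sym_inv_fun f) (sym_fun f).
Proof. by rewrite /sym_inv_fun; case: cid => g []. Qed.

Fact sym_one_subproof : `[< bijective (@id T) >].
Proof. by apply/asboolP; exists id. Qed.

Fact sym_mul_subproof (f g : sym) : `[< bijective (f \o g) >].
Proof.
by apply/asboolP; apply: bij_comp; apply/asboolP; apply: sym_bij.
Qed.

Fact sym_inv_subproof (f : sym) : `[< bijective (sym_inv_fun f) >].
Proof.
by apply/asboolP; exists (sym_fun f); [apply: sym_funVK | apply: sym_funK].
Qed.

Definition sym_one := Sym sym_one_subproof.
Definition sym_mul f g := Sym (sym_mul_subproof f g).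
Definition sym_inv f := Sym (sym_inv_subproof f).

Fact sym_mulA : associative sym_mul.
Proof. by move=> f g h; apply: symP. Qed.
Fact sym_mul1 : left_id sym_one sym_mul.
Proof. by move=> f; apply: symP. Qed.
Fact sym_mulr1 : right_id sym_one sym_mul.
Proof. by move=> f; apply: symP. Qed.
Fact sym_mulV : left_inverse sym_one sym_inv sym_mul.
Proof. by move=> f; apply: symP => x /=; rewrite sym_funK. Qed.
Fact sym_mulrV : right_inverse sym_one sym_inv sym_mul.
Proof. by move=> f; apply: symP => x /=; rewrite sym_funVK. Qed.

HB.instance Definition _ :=
  isGroup.Build sym sym_mulA sym_mul1 sym_mulr1 sym_mulV sym_mulrV.

Definition preserves (op : T -> T -> T) : {pred sym} :=
  fun f => `[< {morph f : x y / op x y} >].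

Lemma preserves_closed op : group_closed (preserves op).
Proof.
split=> [|f g /asboolP fM /asboolP gM]; apply/asboolP => x y //=.
by rewrite -fM -{1}(sym_funVK g x) -{1}(sym_funVK g y) -gM sym_funK.
Qed.

End Symmetric.

Section Automorphisms.
Variable T : choiceType.

Section Quandle.
Variable op : T -> T -> T.

Record quandle_aut := QuandleAut {
  quandle_aut_sym :> sym T;
  quandle_autP : quandle_aut_sym \in preserves op
}.

HB.instance Definition _ := [isSub for quandle_aut_sym].
HB.instance Definition _ := [Choice of quandle_aut by <:].
HB.instance Definition _ :=
  SubChoice_isSubGroup.Build (sym T) _ quandle_aut (preserves_closed op).

End Quandle.

Section Biquandle.
Variables under over : T -> T -> T.

Definition preserves2 : {pred sym T} :=
  fun f => (f \in preserves under) && (f \in preserves over).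

Lemma preserves2_closed : group_closed preserves2.
Proof.
have [u1 uM] := preserves_closed under; have [o1 oM] := preserves_closed over.
split=> [|f g /andP[fu fo] /andP[gu go]]; first exact/andP.
by apply/andP; split; [apply: uM | apply: oM].
Qed.

Record biquandle_aut := BiquandleAut {
  biquandle_aut_sym :> sym T;
  biquandle_autP : biquandle_aut_sym \in preserves2
}.

HB.instance Definition _ := [isSub for biquandle_aut_sym].
HB.instance Definition _ := [Choice of biquandle_aut by <:].
HB.instance Definition _ :=
  SubChoice_isSubGroup.Build (sym T) _ biquandle_aut preserves2_closed.

End Biquandle.
End Automorphisms.

(* MathComp's 'C[a] is only available in finite groups. *)
Section Centralizer.
Local Open Scope group_scope.
Variables (G : groupType) (a : G).

Definition centralizes : {pred G} := fun g => g * a == a * g.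

Lemma centralizes_closed : group_closed centralizes.
Proof.
split=> [|g h /eqP ga /eqP ha]; first by rewrite unfold_in mul1g mulg1.
apply/eqP; rewrite [RHS]mulgA -ga -!mulgA; congr (g * _).
by apply: (mulgI h); rewrite mulVKg mulgA ha mulgK.
Qed.

Record centralizer := Centralizer {
  centralizer_val :> G;
  centralizerP : centralizer_val \in centralizes
}.

HB.instance Definition _ := [isSub for centralizer_val].
HB.instance Definition _ := [Choice of centralizer by <:].
HB.instance Definition _ :=
  SubChoice_isSubGroup.Build G _ centralizer centralizes_closed.

End Centralizer.

Definition isomorphic (G H : groupType) : Prop :=
  exists f : {multiplicative G -> H}, bijective f.

Section Localization.
Variables (R : comNzRingType) (F : fieldType) (iota : {rmorphism R -> F}).
Variables a b : R.

(* The subring R[1/a, 1/b] of F, where R is viewed inside F through iota. *)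
Definition localization : {pred F} := fun x =>
  `[< exists (p : R) (m n : nat), x = iota p / (iota a ^+ m * iota b ^+ n) >].

Hypotheses (a0 : iota a != 0) (b0 : iota b != 0).

Let den_neq0 m n : iota a ^+ m * iota b ^+ n != 0.
Proof. by rewrite mulf_neq0 ?expf_neq0. Qed.

Let denD m n m' n' : iota a ^+ (m + m') * iota b ^+ (n + n') =
  (iota a ^+ m * iota b ^+ n) * (iota a ^+ m' * iota b ^+ n').
Proof. by rewrite !exprD mulrACA. Qed.

Let iota_den m n : iota (a ^+ m * b ^+ n) = iota a ^+ m * iota b ^+ n.
Proof. by rewrite rmorphM !rmorphXn. Qed.

Lemma localization_iota p : iota p \in localization.
Proof. by apply/asboolP; exists p, 0, 0; rewrite !expr0 mulr1 divr1. Qed.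

Lemma localization_invl : (iota a)^-1 \in localization.
Proof. by apply/asboolP; exists 1, 1, 0; rewrite expr0 mulr1 expr1 rmorph1 mul1r. Qed.

Lemma localization_invr : (iota b)^-1 \in localization.
Proof. by apply/asboolP; exists 1, 0, 1; rewrite expr0 mul1r expr1 rmorph1 mul1r. Qed.

Lemma localization_closed : subring_closed localization.
Proof.
split=> [|x y /asboolP[p [m [n ->]]] /asboolP[q [m' [n' ->]]]
         |x y /asboolP[p [m [n ->]]] /asboolP[q [m' [n' ->]]]].
- by rewrite -(rmorph1 iota) localization_iota.
- apply/asboolP; exists (p * (a ^+ m' * b ^+ n') - q * (a ^+ m * b ^+ n)).
  exists (m + m')%N, (n + n')%N.
  rewrite -[- (iota q / _)]mulNr addf_div // mulNr denD rmorphB.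
  by rewrite [iota (p * _)]rmorphM [iota (q * _)]rmorphM !iota_den.
- apply/asboolP; exists (p * q), (m + m')%N, (n + n')%N.
  by rewrite denD rmorphM mulf_div.
Qed.

End Localization.

(* Z[t^±1, s^±1] as the subring Z[t, s][1/t, 1/s] of the field of fractions   *)
(* of Z[t, s]; the variables s and t are the inner and outer variables of     *)
(* {poly {poly int}}, respectively.                                           *)
Section Laurent.

Local Notation P := {poly {poly int}}.
Local Notation K := {fraction P}.
Local Notation iota := (@FracField.tofrac P).

Definition poly_s : P := 'X%:P.
Definition poly_t : P := 'X.

Lemma frac_s_neq0 : iota poly_s != 0.
Proof. by rewrite tofrac_eq0 polyC_eq0 polyX_eq0. Qed.
Lemma frac_t_neq0 : iota poly_t != 0.
Proof. by rewrite tofrac_eq0 polyX_eq0. Qed.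

Definition laurent : {pred K} := localization iota poly_t poly_s.

Lemma laurent_closed : subring_closed laurent.
Proof. exact: localization_closed frac_t_neq0 frac_s_neq0. Qed.

Record Lambda := MkLambda { Lambda_val : K; LambdaP : Lambda_val \in laurent }.

HB.instance Definition _ := [isSub for Lambda_val].
HB.instance Definition _ := [Choice of Lambda by <:].
HB.instance Definition _ :=
  GRing.SubChoice_isSubComNzRing.Build K _ Lambda laurent_closed.

Definition Lambda_unit : {pred Lambda} :=
  fun x => (val x != 0) && ((val x)^-1 \in laurent).
Definition Lambda_inv (x : Lambda) : Lambda :=
  if x \in Lambda_unit then insubd x (val x)^-1 else x.

Fact Lambda_mulVx : {in Lambda_unit, left_inverse 1 Lambda_inv *%R}.
Proof.
move=> x Ux; apply: val_inj; rewrite rmorphM rmorph1 /Lambda_inv Ux /=.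
by have /andP[x0 xV] := Ux; rewrite insubdK // mulVf.
Qed.

Fact Lambda_unitPl (x y : Lambda) : y * x = 1 -> Lambda_unit x.
Proof.
move=> /(congr1 val); rewrite rmorphM rmorph1 /= => yx1.
have x0 : Lambda_val x != 0.
  by apply/eqP => x0; have /eqP := yx1; rewrite x0 mulr0 eq_sym oner_eq0.
apply/andP; split=> //.
suff -> : (Lambda_val x)^-1 = Lambda_val y by apply: LambdaP.
by apply: (mulIf x0); rewrite mulVf.
Qed.

Fact Lambda_inv_out : {in [predC Lambda_unit], Lambda_inv =1 id}.
Proof. by move=> x /negbTE Ux; rewrite /Lambda_inv Ux. Qed.

HB.instance Definition _ := GRing.ComNzRing_hasMulInverse.Build Lambda
  Lambda_mulVx Lambda_unitPl Lambda_inv_out.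

Definition s : Lambda := MkLambda (localization_iota iota poly_t poly_s poly_s).
Definition t : Lambda := MkLambda (localization_iota iota poly_t poly_s poly_t).

Lemma s_unit : s \is a GRing.unit.
Proof.
by apply/andP; split; [exact: frac_s_neq0 | exact: localization_invr].
Qed.

Lemma t_unit : t \is a GRing.unit.
Proof.
by apply/andP; split; [exact: frac_t_neq0 | exact: localization_invl].
Qed.

End Laurent.

Section Alexander.
Variable M : lmodType Lambda.

Definition alexander_under (x y : M) : M := t *: x + (s - t) *: y.
Definition alexander_over (x y : M) : M := s *: x.
Definition alexander_quandle (x y : M) : M :=
  (s^-1 * t) *: x + (1 - s^-1 * t) *: y.

Fact scale_s_bij : `[< bijective (fun x : M => s *: x) >].
Proof.
apply/asboolP; exists (fun x => s^-1 *: x) => x.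
  by rewrite scalerA mulVr ?s_unit ?scale1r.
by rewrite scalerA mulrV ?s_unit ?scale1r.
Qed.

Fact scale_s_preserves : Sym scale_s_bij \in preserves alexander_quandle.
Proof.
apply/asboolP => x y /=.
by rewrite /alexander_quandle scalerDr !scalerA ![s * _]mulrC.
Qed.

Definition scale_s : quandle_aut alexander_quandle :=
  QuandleAut scale_s_preserves.

End Alexander.

(* Main.v *)
(* The biquandle operations and the quandle operation are related by
   under x y = s (x * y), and preserving over means commuting with s. Hence a
   bijection commuting with s preserves under iff it preserves the quandle
   operation. *)
Require Import Defs.
From HB Require Import structures.
From mathcomp Require Import all_boot all_order all_algebra.
From mathcomp Require Import boolp.

Set Implicit Arguments.
Unset Strict Implicit.
Unset Printing Implicit Defensive.

Import GRing.Theory.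
Local Open Scope ring_scope.

Section AlexanderAutomorphisms.
Variable M : lmodType Lambda.

Local Notation under := (@alexander_under M).
Local Notation over := (@alexander_over M).
Local Notation quandle := (@alexander_quandle M).

(** Invertibility of [s] gives s(s^-1 t) = t and s(1 - s^-1 t) = s - t. *)
Lemma alexander_underE (x y : M) : under x y = s *: quandle x y.
Proof.
rewrite /alexander_under /alexander_quandle scalerDr !scalerA.
by rewrite mulrBr mulr1 mulVKr // s_unit.
Qed.

Lemma scale_s_inj : injective (fun x : M => s *: x).
Proof. by have /asboolP/bij_inj := scale_s_bij M. Qed.

Lemma preserves_overP (f : sym M) :
  reflect (forall x, f (s *: x) = s *: f x) (f \in preserves over).
Proof.
(* Since [over x y] is [s *: x] for every [y], the instance [y = x] already yields commutation. *)
by apply: (iffP (asboolP _)) => [fM x | fs x y]; [exact: (fM x x) | exact: fs].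
Qed.

Lemma preserves_under_quandle (f : sym M) :
  f \in preserves over -> (f \in preserves under) = (f \in preserves quandle).
Proof.
move=> /preserves_overP fs; apply/asboolP/asboolP => fM x y.
  (* Scaling the quandle identity by [s] and moving [s] inside [f] turns it into the [under]
     identity. *)
  by apply: scale_s_inj; rewrite -fs -!alexander_underE fM.
by rewrite !alexander_underE fs fM.
Qed.

(** The group law is composition, so commuting with [scale_s M], evaluated at x, reads g(sx) = s
    g(x). *)
Lemma centralizes_scale_s (g : quandle_aut quandle) :
  (g \in centralizes (scale_s M)) =
  (quandle_aut_sym g \in preserves over).
Proof.
apply/eqP/preserves_overP => [gs x | gs].
  by have /(congr1 (fun h : quandle_aut quandle => h x)) := gs.
by apply/val_inj/symP => x; exact: gs.
Qed.

Lemma biquandle_aut_quandle (f : biquandle_aut under over) :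
  biquandle_aut_sym f \in preserves quandle.
Proof.
by case: f => f /= /andP[fu fo]; rewrite -preserves_under_quandle.
Qed.

Definition quandle_of_biquandle_aut (f : biquandle_aut under over) :
  quandle_aut quandle := QuandleAut (biquandle_aut_quandle f).

Lemma quandle_of_biquandle_aut_centralizes f :
  quandle_of_biquandle_aut f \in centralizes (scale_s M).
Proof. by rewrite centralizes_scale_s; case: f => f /= /andP[]. Qed.

(** The isomorphism keeps the underlying bijection; only the attached proofs change. *)
Definition to_centralizer (f : biquandle_aut under over) :
  centralizer (scale_s M) :=
  Centralizer (quandle_of_biquandle_aut_centralizes f).

Lemma centralizer_biquandle (g : centralizer (scale_s M)) :
  quandle_aut_sym (centralizer_val g) \in preserves2 under over.
Proof.
case: g => g /=; rewrite centralizes_scale_s => go.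
by apply/andP; split=> //; rewrite preserves_under_quandle ?quandle_autP.
Qed.

Definition of_centralizer (g : centralizer (scale_s M)) :
  biquandle_aut under over := BiquandleAut (centralizer_biquandle g).

Lemma to_centralizerK : cancel to_centralizer of_centralizer.
Proof. by move=> f; apply: val_inj. Qed.

Lemma of_centralizerK : cancel of_centralizer to_centralizer.
(* A centralizer element wraps a quandle automorphism, which wraps a bijection: one [val_inj] per
   layer. *)
Proof. by move=> g; apply/val_inj/val_inj. Qed.

Lemma to_centralizerM : {morph to_centralizer : f g / (f * g)%g}.
(* Both group laws restrict the one on [sym M], so the underlying bijections agree. *)
Proof. by move=> f g; apply/val_inj/val_inj. Qed.

HB.instance Definition _ :=
  isMultiplicative.Build _ _ to_centralizer to_centralizerM.

End AlexanderAutomorphisms.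

Theorem corollary3p3 (M : lmodType Lambda) :
  isomorphic
    (biquandle_aut (@alexander_under M) (@alexander_over M))
    (centralizer (scale_s M)).
Proof.
exists (to_centralizer (M := M)).
by exists (@of_centralizer M); [exact: to_centralizerK | exact: of_centralizerK].
Qed.
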